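(* Let $p,k,n,m\in\mathbb{Z}$ with $k\ge 0$ and $p\ge 2$, and let $q^{(k)}_j$ denote the coefficient of $u^j$ in the derivative polynomial $Q_k(u)$ associated with $n,m,p$. Then for every integer $j\ge 0$, $$q^{(k)}_j=\sum_{\substack{\mathbf{i}\in\{0,1\}^k\\ |\mathbf{i}|=j}}\ \prod_{l=0}^{k-1}\left(n-l+i_l\,(m-n+pl)+p(1-2i_l)\sum_{r=0}^{l-1}i_r\right),$$ where $\mathbf{i}=(i_0,i_1,\ldots,i_{k-1})\in\{0,1\}^k$ and $|\mathbf{i}|=\sum_{r=0}^{k-1}i_r$.
   Context: For integers $n,m$ and $p\ge2$, the derivative polynomials $Q_k(u)$ are defined by $Q_0(u)=1$ and $Q_{k+1}(u)=\big(n-k+(m+k(p-1))u\big)Q_k(u)+pu(1-u)Q_k'(u)$. Writing $Q_k(u)=\sum_j q^{(k)}_j u^j$, this is equivalent to the recursion $q^{(k+1)}_j=(n-k+pj)\,q^{(k)}_j+\big(m+k(p-1)-p(j-1)\big)\,q^{(k)}_{j-1}$ with $q^{(0)}_0=1$, $q^{(0)}_j=0$ for $j\neq0$, and $q^{(k)}_{j}=0$ for $j<0$. Empty sums are $0$ and empty products are $1$. *)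

(* Defs.v *)
From mathcomp Require Import all_boot all_order all_algebra.

Set Implicit Arguments.
Unset Strict Implicit.
Unset Printing Implicit Defensive.

Import GRing.Theory.
Local Open Scope ring_scope.

Fixpoint derivpoly (n m p : int) (k : nat) : {poly int} :=
  if k is k'.+1 then
    ((n - k'%:Z)%:P + (m + k'%:Z * (p - 1)) *: 'X) * derivpoly n m p k'
      + p *: ('X * (1 - 'X) * (derivpoly n m p k')^`())
  else 1.

(* Elements of {0,1}^k are functions 'I_k -> bool, a bit being read as an
   integer through the coercion of bool to nat. *)
Definition weight (k : nat) (i : {ffun 'I_k -> bool}) : nat :=
  (\sum_(r < k) i r)%N.

(* Main.v *)
Require Import Defs.
From mathcomp Require Import all_boot all_order all_algebra.
From mathcomp Require Import ring.

Set Implicit Arguments.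
Unset Strict Implicit.
Unset Printing Implicit Defensive.

Import GRing.Theory.
Local Open Scope ring_scope.

(** The operator taking [derivpoly n m p k] to [derivpoly n m p k.+1] is linear
    and sends a monomial ['X^s] to a combination of ['X^s] and ['X^(s.+1)]
    ([derivpoly_step_monomial]).  Starting from [1] and applying [k] such
    operators, each expansion of the result chooses one of the two terms at each
    step.  A bit string [i] records these choices: the bit [i l] says whether
    step [l] raises the exponent, so before step [l] the exponent is
    [\sum_(r < l) i r], and in the end it is [weight i].  The coefficient picked
    up at step [l] is, in both cases, the [l]-th factor of the product in the
    theorem.  Hence [derivpoly n m p k] is the sum over all strings [i] of the
    product of these factors times ['X^(weight i)] ([derivpoly_sum_bits]), and
    the theorem reads off the coefficient of ['X^j]. *)

(** The bit appended by [rcons_bits] is the choice made at the last step. *)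
Definition rcons_bits k (i : {ffun 'I_k -> bool}) (b : bool) :
    {ffun 'I_k.+1 -> bool} :=
  [ffun l => if unlift ord_max l is Some l' then i l' else b].

Lemma rcons_bits_max k (i : {ffun 'I_k -> bool}) b :
  rcons_bits i b ord_max = b.
Proof. by rewrite ffunE unlift_none. Qed.

Lemma rcons_bits_widen k (i : {ffun 'I_k -> bool}) b (l : 'I_k) :
  rcons_bits i b (widen_ord (leqnSn k) l) = i l.
Proof.
have ->: widen_ord (leqnSn k) l = lift ord_max l.
  by apply/val_inj; rewrite /= /bump leqNgt ltn_ord.
by rewrite ffunE liftK.
Qed.

Lemma sum_bits_recr (V : nmodType) k (F : {ffun 'I_k.+1 -> bool} -> V) :
  \sum_i F i = \sum_i (F (rcons_bits i false) + F (rcons_bits i true)).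
Proof.
rewrite (reindex (fun ib : {ffun 'I_k -> bool} * bool =>
                    rcons_bits ib.1 ib.2)) /=.
  rewrite -(pair_bigA _ (fun i b => F (rcons_bits i b))) /=.
  by apply: eq_bigr => i _; rewrite big_bool addrC.
exists (fun i => ([ffun l => i (widen_ord (leqnSn k) l)], i ord_max)).
  move=> [i b] _; rewrite /= rcons_bits_max; congr pair.
  by apply/ffunP=> l; rewrite ffunE rcons_bits_widen.
move=> i _; apply/ffunP=> l; rewrite ffunE.
case: unliftP => [l' ->|-> //]; rewrite ffunE; congr (i _).
by apply/val_inj; rewrite /= /bump leqNgt ltn_ord.
Qed.

Lemma weight_rcons_bits k (i : {ffun 'I_k -> bool}) b :
  weight (rcons_bits i b) = (weight i + b)%N.
Proof.
rewrite /weight big_ord_recr /= rcons_bits_max; congr (_ + _)%N.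
by apply: eq_bigr => l _; rewrite rcons_bits_widen.
Qed.

Definition step_factor (n m p : int) k (i : {ffun 'I_k -> bool}) (l : 'I_k) :
    int :=
  n - l%:Z + (i l)%:Z * (m - n + p * l%:Z)
  + p * (1 - 2 * (i l)%:Z) * \sum_(r < k | (r < l)%N) (i r)%:Z.

(** The cutoff [r < l] keeps the appended bit out of the earlier factors, which
    is what lets the induction on [k] split off the last factor alone. *)
Lemma step_factor_widen n m p k (i : {ffun 'I_k -> bool}) b (l : 'I_k) :
  step_factor n m p (rcons_bits i b) (widen_ord (leqnSn k) l)
    = step_factor n m p i l.
Proof.
rewrite /step_factor rcons_bits_widen big_mkcond big_ord_recr /=.
rewrite ltnNge (ltnW (ltn_ord l)) addr0 -big_mkcond.
by under eq_bigr do rewrite rcons_bits_widen.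
Qed.

Lemma step_factor_max n m p k (i : {ffun 'I_k -> bool}) b :
  step_factor n m p (rcons_bits i b) ord_max
    = n - k%:Z + b%:Z * (m - n + p * k%:Z)
      + p * (1 - 2 * b%:Z) * (weight i)%:Z.
Proof.
rewrite /step_factor rcons_bits_max big_mkcond big_ord_recr /= ltnn addr0.
congr (_ + _ * _); rewrite /weight -natz natr_sum.
by apply: eq_bigr => r _; rewrite ltn_ord rcons_bits_widen natz.
Qed.

Lemma mulX_derivXn (R : nzRingType) s :
  'X * ('X^s)^`() = 'X^s *+ s :> {poly R}.
Proof. by case: s => [|s]; rewrite derivXn ?mulr0n ?mulr0 // mulrnAr -exprS. Qed.

(** The Euler operator ['X * d/dX] is diagonal on monomials, so multiplying by
    the affine parts leaves only the exponents [s] and [s.+1]. *)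
Lemma derivpoly_step_monomial (a c p : int) s :
  (a%:P + c *: 'X) * 'X^s + p *: ('X * (1 - 'X) * ('X^s)^`())
    = (a + p * s%:Z) *: 'X^s + (c - p * s%:Z) *: 'X^(s.+1).
Proof.
rewrite -mulrA mulrCA mulX_derivXn -scaler_nat -natz -!mul_polyC exprS.
rewrite !(polyCD, polyCN, polyCM) polyC_natr; ring.
Qed.

Lemma derivpoly_sum_bits n m p k :
  derivpoly n m p k =
    \sum_(i : {ffun 'I_k -> bool})
      (\prod_(l < k) step_factor n m p i l) *: 'X^(weight i).
Proof.
elim: k => [|k IHk].
  (* There is exactly one bit string of length 0. *)
  have i0 : {ffun 'I_0 -> bool} by exact: [ffun=> false].
  rewrite (big_pred1 i0) => [|i]; last by apply/esym/eqP/ffunP=> -[].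
  by rewrite big_ord0 scale1r /weight big_ord0.
rewrite sum_bits_recr /= IHk raddf_sum !mulr_sumr scaler_sumr -big_split /=.
apply: eq_bigr => i _; rewrite derivZ -!scalerAr scalerA [p * _]mulrC -scalerA.
rewrite -scalerDr derivpoly_step_monomial !weight_rcons_bits addn0 addn1.
rewrite !big_ord_recr /= !step_factor_max.
under [in RHS]eq_bigr do rewrite step_factor_widen.
under [X in _ = _ + (X * _) *: _]eq_bigr do rewrite step_factor_widen.
by rewrite scalerDr !scalerA; congr (_ *: _ + _ *: _); rewrite /=; ring.
Qed.

Theorem theorem4p1 (p n m : int) (k : nat) (hp : 2 <= p) (j : nat) :
  (derivpoly n m p k)`_j =
    \sum_(i : {ffun 'I_k -> bool} | weight i == j)
      \prod_(l < k)
        (n - l%:Z + (i l)%:Z * (m - n + p * l%:Z)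
         + p * (1 - 2 * (i l)%:Z) * \sum_(r < k | (r < l)%N) (i r)%:Z).
Proof.
rewrite derivpoly_sum_bits coef_sum [RHS]big_mkcond; apply: eq_bigr => i _.
by rewrite coefZ coefXn eq_sym; case: eqP => _; rewrite ?mulr1 ?mulr0.
Qed.
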